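(* Let $q$ be a nonzero complex number with $|q|<1$, and let $a,b,c$ be nonzero complex numbers with $\left|\frac{cq^2}{ab}\right|<1$ and $ab\ne cq$. Put $$d=\frac{abq+abc-acq-bcq}{(ab-cq)\,q}.$$ Assume that no zero denominators occur, i.e. $a\neq q$, $b\ne q$, and $c q^{k}\neq 1$ and $dq^{k+2}\neq 1$ for all integers $k\ge 0$. Then $${}_3\phi_2\!\left[\begin{matrix}a,\,b,\,d\\ c,\,dq^2\end{matrix};q,\frac{cq^2}{ab}\right]=-\frac{(ab-cq)(1-d)(1-dq)\,q}{(1-q)(q-a)(q-b)\,c}\;\frac{(cq/a;q)_\infty\,(cq/b;q)_\infty}{(c;q)_\infty\,(cq^2/(ab);q)_\infty}.$$
   Context: For $|q|<1$ and complex $x$: $(x;q)_0=1$, $(x;q)_n=\prod_{k=0}^{n-1}(1-xq^k)$ for $n\ge1$, and $(x;q)_\infty=\prod_{k=0}^{\infty}(1-xq^k)$. The basic hypergeometric series is $${}_3\phi_2\!\left[\begin{matrix}a_1,a_2,a_3\\ b_1,b_2\end{matrix};q,x\right]=\sum_{n=0}^{\infty}\frac{(a_1;q)_n(a_2;q)_n(a_3;q)_n}{(q;q)_n(b_1;q)_n(b_2;q)_n}x^n .$$ *)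

(* Defs.v *)
(* Stdlib reals with Coquelicot's complex numbers [C]. *)
From Stdlib Require Import Reals.
From Coquelicot Require Import Coquelicot.
Open Scope C_scope.

Fixpoint qpoch (x q : C) (n : nat) : C :=
  match n with
  | O => 1
  | S k => qpoch x q k * (1 - x * q ^ k)
  end.

(* As for [RInt], [iota] turns the limit relation into a total function, whose
   value is meaningful only when the limit exists (here, when |q| < 1). *)
Definition qpoch_inf (x q : C) : C :=
  iota (fun l : C_CompleteNormedModule =>
          filterlim (qpoch x q) eventually (locally l)).

Definition phi32_term (a1 a2 a3 b1 b2 q x : C) (n : nat) : C :=
  qpoch a1 q n * qpoch a2 q n * qpoch a3 q n
  / (qpoch q q n * qpoch b1 q n * qpoch b2 q n) * x ^ n.

Definition phi32_converges (a1 a2 a3 b1 b2 q x : C) : Prop :=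
  ex_series (V := C_NormedModule) (phi32_term a1 a2 a3 b1 b2 q x).

(* Meaningful only under [phi32_converges a1 a2 a3 b1 b2 q x]. *)
Definition phi32 (a1 a2 a3 b1 b2 q x : C) : C :=
  iota (fun l : C_CompleteNormedModule =>
          is_series (phi32_term a1 a2 a3 b1 b2 q x) l).

(* Main.v *)
Require Import Defs.
From Stdlib Require Import Reals Lra.
From Coquelicot Require Import Coquelicot.
Open Scope C_scope.

(** Put [A = a/q], [B = b/q] and [X = c/(AB)], which is the argument of the
    series.  Two facts make the evaluation work.

    First, the parameter [d] is chosen so that the series is, up to a constant
    factor, a 2phi1 in disguise.  The quotient [(d;q)_n / (dq^2;q)_n] collapses
    to [(1-d)(1-dq) / ((1-dq^n)(1-dq^(n+1)))] (if this is not 0/0), and the definition of [d] reads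
    [d (X - q) = XA + XB - q - XAB].  Writing [g_n] for the terms of
    [2phi1(A, B; c; q, X)], this relation makes the term of the 3phi2 minus
    [(1-dq)/(1-q) g_n] telescope ([phi32_partial_sum]); the boundary term
    contains [g_n] and tends to 0.  As [1-d = -c(q-a)(q-b)/((ab-cq)q)], the
    prefactor of the right-hand side is exactly [(1-dq)/(1-q)].

    Secondly, that 2phi1 is summed by Gauss's q-analogue
    [2phi1(A, B; c; q, c/(AB)) = (c/A)_oo (c/B)_oo / ((c)_oo (c/(AB))_oo)]
    ([q_gauss_sum]).  Its proof is again by telescoping: the sums for [c] and
    for [cq] are proportional ([gauss_contiguous]).  Iterating [N] times
    produces the four finite products ([gauss_iterate]), and the sum for
    [c q^N] tends to 1, because its argument [X q^N] tends to 0 while its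
    coefficients stay bounded ([gauss_shifted_near_1]).

    The analytic input is that [(x;q)_n] converges, is bounded, and stays away
    from 0 when none of its factors vanishes ([qpoch_Clim], [qpoch_bounded],
    [qpoch_bounded_below]). *)

(** * Limits of complex sequences *)

(** The uniform structure is fixed to the product one, so that instances
    coming from [C] as a ring and as a normed module do not mix. *)
Definition Clim (u : nat -> C) (l : C) : Prop :=
  filterlim u eventually (locally (T := C_UniformSpace) l).

(** Gives access to the order and squeeze theorems for real limits. *)
Lemma Clim_Cmod (u : nat -> C) (l : C) :
  is_lim_seq (fun n => Cmod (u n - l)) 0%R <-> Clim u l.
Proof.
  split; intro H.
  - apply (filterlim_locally_ball_norm (K := C_AbsRing) (U := C_NormedModule)).
    intro eps. apply is_lim_seq_spec in H. destruct (H eps) as [N HN].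
    exists N. intros n Hn. specialize (HN n Hn).
    rewrite Rminus_0_r, Rabs_pos_eq in HN by apply Cmod_ge_0. exact HN.
  - apply is_lim_seq_spec. intro eps.
    destruct (proj1 (filterlim_locally_ball_norm (K := C_AbsRing)
      (U := C_NormedModule) u l) H eps) as [N HN].
    exists N. intros n Hn. specialize (HN n Hn).
    rewrite Rminus_0_r, Rabs_pos_eq by apply Cmod_ge_0. exact HN.
Qed.

Lemma Clim_const (l : C) : Clim (fun _ => l) l.
Proof. apply filterlim_const. Qed.

Lemma Clim_ext (u v : nat -> C) (l : C) :
  (forall n, u n = v n) -> Clim u l -> Clim v l.
Proof. apply filterlim_ext. Qed.

Lemma Clim_plus (u v : nat -> C) (l m : C) :
  Clim u l -> Clim v m -> Clim (fun n => u n + v n) (l + m).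
Proof.
  intros Hu Hv.
  exact (filterlim_comp_2 u v Cplus Hu Hv
    (filterlim_plus (V := C_NormedModule) l m)).
Qed.

Lemma Clim_mult (u v : nat -> C) (l m : C) :
  Clim u l -> Clim v m -> Clim (fun n => u n * v n) (l * m).
Proof.
  intros Hu Hv.
  apply (filterlim_comp_2 (G := locally (T := AbsRing_UniformSpace C_AbsRing) l)
    (H := locally (T := C_UniformSpace) m) u v Cmult).
  - intros P HP. apply Hu. apply locally_C. exact HP.
  - exact Hv.
  - exact (filterlim_scal (V := C_NormedModule) l m).
Qed.

Lemma Clim_minus (u v : nat -> C) (l m : C) :
  Clim u l -> Clim v m -> Clim (fun n => u n - v n) (l - m).
Proof.
  intros Hu Hv. apply Clim_plus; [exact Hu|].
  apply (Clim_ext (fun n => (-1) * v n)); [intro; ring|].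
  replace (- m) with ((-1) * m) by ring.
  apply Clim_mult; [apply Clim_const | exact Hv].
Qed.

Lemma Clim_incr (u : nat -> C) (l : C) : Clim u l -> Clim (fun n => u (S n)) l.
Proof.
  intro H. apply Clim_Cmod.
  apply (is_lim_seq_incr_1 (fun n => Cmod (u n - l))), Clim_Cmod, H.
Qed.

Lemma Clim_unique (u : nat -> C) (l m : C) : Clim u l -> Clim u m -> l = m.
Proof. apply (filterlim_locally_unique (V := C_NormedModule)). Qed.

Lemma Clim_0_le (u : nat -> C) (r : nat -> R) :
  (forall n, Cmod (u n) <= r n)%R -> is_lim_seq r 0%R -> Clim u 0.
Proof.
  intros Hle Hr. apply Clim_Cmod.
  apply is_lim_seq_le_le with (fun _ => 0%R) r; [|apply is_lim_seq_const|exact Hr].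
  intro n. split; [apply Cmod_ge_0|].
  replace (u n - 0) with (u n) by ring. apply Hle.
Qed.

Lemma is_lim_seq_scal_0 (K : R) (r : nat -> R) :
  is_lim_seq r 0%R -> is_lim_seq (fun n => K * r n)%R 0%R.
Proof.
  intro H. apply (is_lim_seq_scal_l _ K) in H. simpl in H.
  rewrite Rmult_0_r in H. exact H.
Qed.

Lemma Clim_0_bounded_mult (u v : nat -> C) (M : R) :
  (forall n, Cmod (u n) <= M)%R -> Clim v 0 -> Clim (fun n => u n * v n) 0.
Proof.
  intros Hu Hv. apply Clim_0_le with (fun n => M * Cmod (v n - 0))%R.
  - intro n. replace (v n - 0) with (v n) by ring. rewrite Cmod_mult.
    apply Rmult_le_compat_r; [apply Cmod_ge_0 | apply Hu].
  - apply is_lim_seq_scal_0. apply Clim_Cmod, Hv.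
Qed.

Lemma Clim_pow (q : C) : (Cmod q < 1)%R -> Clim (fun n => q ^ n) 0.
Proof.
  intro Hq. apply Clim_0_le with (fun n => Cmod q ^ n)%R.
  - intro n. rewrite Cmod_pow. lra.
  - apply is_lim_seq_geom. rewrite Rabs_pos_eq by apply Cmod_ge_0. exact Hq.
Qed.

Lemma Clim_Cmod_le (u : nat -> C) (l : C) (M : R) :
  (forall n, Cmod (u n) <= M)%R -> Clim u l -> (Cmod l <= M)%R.
Proof.
  intros Hu Hl.
  assert (H : is_lim_seq (fun n => M + Cmod (u n - l))%R (M + 0)%R).
  { apply is_lim_seq_plus'; [apply is_lim_seq_const | apply Clim_Cmod, Hl]. }
  rewrite Rplus_0_r in H.
  refine (is_lim_seq_le (fun _ => Cmod l) _ (Cmod l) M _ _ H);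
    [|apply is_lim_seq_const].
  intro n. replace l with (u n + - (u n - l)) at 1 by ring.
  eapply Rle_trans; [apply Cmod_triangle|]. rewrite Cmod_opp.
  apply Rplus_le_compat_r, Hu.
Qed.

Lemma Clim_Cmod_ge (u : nat -> C) (l : C) (m : R) :
  (forall n, m <= Cmod (u n))%R -> Clim u l -> (m <= Cmod l)%R.
Proof.
  intros Hu Hl.
  assert (H : is_lim_seq (fun n => Cmod l + Cmod (u n - l))%R (Cmod l + 0)%R).
  { apply is_lim_seq_plus'; [apply is_lim_seq_const | apply Clim_Cmod, Hl]. }
  rewrite Rplus_0_r in H.
  refine (is_lim_seq_le (fun _ => m) _ m (Cmod l) _ _ H);
    [|apply is_lim_seq_const].
  intro n. eapply Rle_trans; [apply Hu|].
  replace (u n) with (l + (u n - l)) at 1 by ring. apply Cmod_triangle.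
Qed.

(** The next two restate facts about [sum_n] with the ring operations of [C], in
    the form that [ring] and [field] recognize. *)
Lemma Csum_0 (u : nat -> C) : sum_n u 0 = u 0%nat.
Proof. exact (sum_O (G := C_AbelianMonoid) u). Qed.

Lemma Csum_S (u : nat -> C) (n : nat) : sum_n u (S n) = sum_n u n + u (S n).
Proof. exact (sum_Sn (G := C_AbelianMonoid) u n). Qed.

(** * The shifted factorials *)

Lemma pow_unit_interval (r : R) (n : nat) : (0 <= r <= 1 -> 0 <= r ^ n <= 1)%R.
Proof.
  intro H. split; [now apply pow_le|]. rewrite <- (pow1 n). now apply pow_incr.
Qed.

Lemma Cminus_neq_0 (x y : C) : x <> y -> x - y <> 0.
Proof.
  intros H E. apply H. replace x with (x - y + y) by ring. rewrite E. ring.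
Qed.

Lemma one_minus_neq_0 (x : C) : x <> 1 -> 1 - x <> 0.
Proof. intro H. now apply Cminus_neq_0, not_eq_sym. Qed.

Lemma Cmod_mult_pow_lt (q x : C) (k : nat) :
  (Cmod q < 1)%R -> (Cmod x < 1)%R -> (Cmod (x * q ^ k) < 1)%R.
Proof.
  intros Hq Hx. rewrite Cmod_mult, Cmod_pow.
  pose proof (Cmod_ge_0 q). pose proof (Cmod_ge_0 x).
  assert (0 <= Cmod q ^ k <= 1)%R by (apply pow_unit_interval; lra).
  nra.
Qed.

Lemma neq_1_of_Cmod_lt (x : C) : (Cmod x < 1)%R -> x <> 1.
Proof. intros H E. rewrite E, Cmod_1 in H. lra. Qed.

Lemma qpoch_head (x q : C) (n : nat) :
  qpoch x q (S n) = (1 - x) * qpoch (x * q) q n.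
Proof.
  induction n as [|n IH]; [simpl; ring|].
  change (qpoch x q (S (S n))) with (qpoch x q (S n) * (1 - x * q ^ S n)).
  rewrite IH. simpl. ring.
Qed.

Lemma qpoch_add (x q : C) (m n : nat) :
  qpoch x q (m + n) = qpoch x q m * qpoch (x * q ^ m) q n.
Proof.
  induction n as [|n IH].
  - rewrite Nat.add_0_r. simpl. ring.
  - rewrite Nat.add_succ_r. simpl. rewrite IH, Cpow_add_r. ring.
Qed.

Lemma qpoch_neq_0 (x q : C) (n : nat) :
  (forall k, x * q ^ k <> 1) -> qpoch x q n <> 0.
Proof.
  intro H. induction n as [|n IH]; simpl.
  - exact C1_nz.
  - apply Cmult_neq_0; [exact IH | apply one_minus_neq_0, H].
Qed.

Lemma geom_nonneg (r : R) (n : nat) :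
  (0 <= r < 1 -> 0 <= (1 - r ^ n) / (1 - r) <= 1 / (1 - r))%R.
Proof.
  intros [H0 H1].
  assert (0 <= r ^ n <= 1)%R by (apply pow_unit_interval; lra).
  assert (0 < / (1 - r))%R by (apply Rinv_0_lt_compat; lra).
  unfold Rdiv. split; nra.
Qed.

(** Since [|1 - x q^k| <= exp (|x| |q|^k)], the product is at most the
    exponential of a geometric sum. *)
Lemma qpoch_bounded (x q : C) :
  (Cmod q < 1)%R ->
  exists M, (0 < M)%R /\ forall n, (Cmod (qpoch x q n) <= M)%R.
Proof.
  intro Hq. pose proof (Cmod_ge_0 q) as Hq0. pose proof (Cmod_ge_0 x) as Hx0.
  exists (exp (Cmod x * (1 / (1 - Cmod q)))). split; [apply exp_pos|].
  assert (H : forall n, (Cmod (qpoch x q n)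
            <= exp (Cmod x * ((1 - Cmod q ^ n) / (1 - Cmod q))))%R).
  { induction n as [|n IH]; simpl.
    - replace (Cmod x * ((1 - 1) / (1 - Cmod q)))%R with 0%R by (field; lra).
      rewrite exp_0, Cmod_1. lra.
    - replace (Cmod x * ((1 - Cmod q * Cmod q ^ n) / (1 - Cmod q)))%R
        with (Cmod x * ((1 - Cmod q ^ n) / (1 - Cmod q))
              + Cmod x * Cmod q ^ n)%R by (field; lra).
      rewrite exp_plus, Cmod_mult.
      apply Rmult_le_compat; try apply Cmod_ge_0; [exact IH|].
      eapply Rle_trans; [apply Cmod_triangle|].
      rewrite Cmod_opp, Cmod_1, Cmod_mult, Cmod_pow. apply exp_ineq1_le. }
  intro n. eapply Rle_trans; [apply H|].
  destruct (geom_nonneg (Cmod q) n (conj Hq0 Hq)) as [_ Hg].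
  assert (Hle : (Cmod x * ((1 - Cmod q ^ n) / (1 - Cmod q))
     <= Cmod x * (1 / (1 - Cmod q)))%R) by now apply Rmult_le_compat_l.
  destruct Hle as [Hlt|Heq]; [left; now apply exp_increasing|right; now rewrite Heq].
Qed.

(** By [prod (1 - u_k) >= 1 - sum u_k] for [u_k] in the unit interval, applied
    to [u_k = |x| |q|^k], whose sum is at most [|x| / (1 - |q|)]. *)
Lemma qpoch_ge_half (x q : C) (n : nat) :
  (Cmod q < 1)%R -> (Cmod x <= (1 - Cmod q) / 2)%R ->
  (1 / 2 <= Cmod (qpoch x q n))%R.
Proof.
  intros Hq Hx. pose proof (Cmod_ge_0 q) as Hq0. pose proof (Cmod_ge_0 x) as Hx0.
  assert (H : (1 - Cmod x * ((1 - Cmod q ^ n) / (1 - Cmod q))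
               <= Cmod (qpoch x q n))%R).
  { induction n as [|n IH]; simpl.
    - rewrite Cmod_1. apply Req_le. field. lra.
    - destruct (geom_nonneg (Cmod q) n (conj Hq0 Hq)) as [Hg _].
      replace ((1 - Cmod q * Cmod q ^ n) / (1 - Cmod q))%R
        with ((1 - Cmod q ^ n) / (1 - Cmod q) + Cmod q ^ n)%R by (field; lra).
      set (g := ((1 - Cmod q ^ n) / (1 - Cmod q))%R) in *.
      rewrite Cmod_mult.
      assert (Hf : (1 - Cmod x * Cmod q ^ n <= Cmod (1 - x * q ^ n))%R).
      { pose proof (Cmod_triangle (1 - x * q ^ n) (x * q ^ n)) as T.
        replace (1 - x * q ^ n + x * q ^ n) with (RtoC 1) in T by ring.
        rewrite Cmod_1, Cmod_mult, Cmod_pow in T. lra. }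
      assert (Hp : (0 <= Cmod q ^ n <= 1)%R) by (apply pow_unit_interval; lra).
      pose proof (Cmod_ge_0 (qpoch x q n)).
      assert (0 <= Cmod x * Cmod q ^ n <= 1)%R by (split; nra).
      assert (0 <= Cmod x * g)%R by nra.
      apply Rle_trans with (Cmod (qpoch x q n) * (1 - Cmod x * Cmod q ^ n))%R;
        [nra | apply Rmult_le_compat_l; assumption]. }
  eapply Rle_trans; [|exact H].
  destruct (geom_nonneg (Cmod q) n (conj Hq0 Hq)) as [Hg0 Hg].
  assert (E : ((1 - Cmod q) / 2 * (1 / (1 - Cmod q)) = 1 / 2)%R) by (field; lra).
  assert (Cmod x * ((1 - Cmod q ^ n) / (1 - Cmod q))
          <= (1 - Cmod q) / 2 * (1 / (1 - Cmod q)))%R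
    by now apply Rmult_le_compat.
  lra.
Qed.

(** Peeling off finitely many leading factors replaces [x] by some [x q^N] so
    small that [qpoch_ge_half] applies; the peeled factors are nonzero. *)
Lemma qpoch_bounded_below (x q : C) :
  (Cmod q < 1)%R -> (forall k, x * q ^ k <> 1) ->
  exists m, (0 < m)%R /\ forall n, (m <= Cmod (qpoch x q n))%R.
Proof.
  intros Hq. pose proof (Cmod_ge_0 q) as Hq0.
  assert (Hsmall : exists N, (Cmod (x * q ^ N) <= (1 - Cmod q) / 2)%R).
  { assert (Hl : Clim (fun n => x * q ^ n) 0).
    { replace (RtoC 0) with (x * 0) by ring.
      apply Clim_mult; [apply Clim_const | now apply Clim_pow]. }
    apply Clim_Cmod, is_lim_seq_spec in Hl.
    assert (He : (0 < (1 - Cmod q) / 2)%R) by lra.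
    destruct (Hl (mkposreal _ He)) as [N HN]. exists N.
    specialize (HN N (le_n N)). simpl in HN.
    rewrite Rminus_0_r, Rabs_pos_eq in HN by apply Cmod_ge_0.
    replace (x * q ^ N) with (x * q ^ N - 0) by ring. lra. }
  (* Induction on the number of factors to peel, with [x] moving to [x * q]. *)
  destruct Hsmall as [N HN]. revert x HN.
  induction N as [|N IH]; intros x HN Hx.
  - exists (1 / 2)%R. split; [lra|]. intro n. apply qpoch_ge_half; [exact Hq|].
    simpl in HN. now rewrite Cmult_1_r in HN.
  - destruct (IH (x * q)) as [m [Hm Hb]].
    + replace (x * q * q ^ N) with (x * q ^ S N) by (simpl; ring). exact HN.
    + intro k. replace (x * q * q ^ k) with (x * q ^ S k) by (simpl; ring).
      apply Hx.
    + assert (H1 : 1 - x <> 0).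
      { apply one_minus_neq_0. specialize (Hx 0%nat). simpl in Hx.
        now rewrite Cmult_1_r in Hx. }
      apply Cmod_gt_0 in H1.
      (* The 1 accounts for the empty product. *)
      exists (Rmin 1 (Cmod (1 - x) * m)). split.
      * apply Rmin_glb_lt; [lra|]. now apply Rmult_lt_0_compat.
      * intros [|n].
        -- simpl. rewrite Cmod_1. apply Rmin_l.
        -- rewrite qpoch_head, Cmod_mult. eapply Rle_trans; [apply Rmin_r|].
           apply Rmult_le_compat_l; [lra | apply Hb].
Qed.

(** The increments [- (x;q)_n x q^n] are dominated by a geometric sequence, as
    [(x;q)_n] is bounded; hence they are summable. *)
Lemma qpoch_Clim (x q : C) :
  (Cmod q < 1)%R -> Clim (qpoch x q) (qpoch_inf x q).
Proof.
  intro Hq. pose proof (Cmod_ge_0 q) as Hq0.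
  destruct (qpoch_bounded x q Hq) as [M [HM Hb]].
  assert (Hs : ex_series (V := C_CompleteNormedModule)
                 (fun n => - qpoch x q n * (x * q ^ n))).
  { apply (ex_series_le (V := C_CompleteNormedModule)) with
      (fun n => M * Cmod x * Cmod q ^ n)%R.
    - intro n. change (Cmod (- qpoch x q n * (x * q ^ n))
                       <= M * Cmod x * Cmod q ^ n)%R.
      rewrite !Cmod_mult, Cmod_opp, Cmod_pow, <- Rmult_assoc.
      apply Rmult_le_compat_r; [now apply pow_le|].
      apply Rmult_le_compat_r; [apply Cmod_ge_0 | apply Hb].
    - apply (ex_series_scal (K := R_AbsRing) (V := R_NormedModule) (M * Cmod x)%R).
      apply ex_series_geom. now rewrite Rabs_pos_eq. }
  destruct Hs as [l Hl].
  assert (H : Clim (qpoch x q) (1 + l)).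
  { apply Clim_Cmod, is_lim_seq_incr_1.
    apply (Clim_Cmod (fun n => qpoch x q (S n))).
    apply (Clim_ext
      (fun n => 1 + sum_n (fun n => - qpoch x q n * (x * q ^ n)) n)).
    - induction n as [|n IH].
      + rewrite Csum_0. simpl. ring.
      + rewrite Csum_S, Cplus_assoc, IH. simpl. ring.
    - apply Clim_plus; [apply Clim_const | exact Hl]. }
  unfold qpoch_inf. rewrite (iota_filterlim_locally (qpoch x q) (1 + l)); exact H.
Qed.

Lemma qpoch_inf_neq_0 (x q : C) :
  (Cmod q < 1)%R -> (forall k, x * q ^ k <> 1) -> qpoch_inf x q <> 0.
Proof.
  intros Hq Hx. destruct (qpoch_bounded_below x q Hq Hx) as [m [Hm Hb]].
  apply Cmod_gt_0. apply Rlt_le_trans with m; [exact Hm|].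
  apply Clim_Cmod_ge with (qpoch x q); [exact Hb | now apply qpoch_Clim].
Qed.

(** * The q-Gauss sum *)

(** The terms of [2phi1(A, B; c; q, c/(AB))]: the argument is tied to the
    parameters, so that replacing [c] by [c * q] also multiplies it by [q]. *)
Definition gauss_term (A B c q : C) (n : nat) : C :=
  qpoch A q n * qpoch B q n / (qpoch q q n * qpoch c q n) * (c / (A * B)) ^ n.

Lemma pow_q_neq_1 (q : C) (k : nat) : (Cmod q < 1)%R -> q * q ^ k <> 1.
Proof. intro Hq. now apply neq_1_of_Cmod_lt, Cmod_mult_pow_lt. Qed.

Lemma shift_neq_1 (c q : C) (N : nat) :
  (forall k, c * q ^ k <> 1) -> forall k, c * q ^ N * q ^ k <> 1.
Proof.
  intros Hc k. rewrite <- Cmult_assoc, <- Cpow_add_r. apply Hc.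
Qed.

Lemma gauss_term_S (A B c q : C) (n : nat) :
  (Cmod q < 1)%R -> A <> 0 -> B <> 0 -> (forall k, c * q ^ k <> 1) ->
  (1 - q * q ^ n) * (1 - c * q ^ n) * gauss_term A B c q (S n)
  = (1 - A * q ^ n) * (1 - B * q ^ n) * (c / (A * B)) * gauss_term A B c q n.
Proof.
  intros Hq HA HB Hc. unfold gauss_term. simpl.
  pose proof (qpoch_neq_0 c q n Hc).
  pose proof (qpoch_neq_0 q q n (fun k => pow_q_neq_1 q k Hq)).
  pose proof (one_minus_neq_0 _ (Hc n)).
  pose proof (one_minus_neq_0 _ (pow_q_neq_1 q n Hq)).
  field. repeat split; assumption.
Qed.

Lemma gauss_term_shift (A B c q : C) (n : nat) :
  (Cmod q < 1)%R -> A <> 0 -> B <> 0 -> (forall k, c * q ^ k <> 1) ->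
  (1 - c * q ^ n) * gauss_term A B (c * q) q n
  = (1 - c) * q ^ n * gauss_term A B c q n.
Proof.
  intros Hq HA HB Hc. unfold gauss_term.
  replace (c * q / (A * B)) with (c / (A * B) * q) by (field; now split).
  rewrite Cpow_mult_l.
  pose proof (qpoch_neq_0 c q n Hc) as H1.
  pose proof (qpoch_neq_0 q q n (fun k => pow_q_neq_1 q k Hq)) as H2.
  pose proof (qpoch_neq_0 c q (S n) Hc) as H3.
  pose proof (qpoch_head c q n) as Hh. simpl in Hh.
  assert (H4 : qpoch (c * q) q n <> 0).
  { intro E. rewrite qpoch_head, E in H3. apply H3. ring. }
  set (X := (c / (A * B)) ^ n). field_simplify_eq; [|now repeat split].
  transitivity (qpoch A q n * qpoch B q n * X * q ^ n * (qpoch c q n * (1 - c * q ^ n)));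
    [ring|]. rewrite Hh. ring.
Qed.

(** The combination of the terms for [c] and [c * q] on the left is the
    difference of [(1 - c) (1 - q^k) g_k] at [k] and [k + 1], and this quantity
    vanishes at [k = 0], so only the upper boundary term survives. *)
Lemma gauss_sum_contiguous (A B c q : C) (n : nat) :
  (Cmod q < 1)%R -> A <> 0 -> B <> 0 -> (forall k, c * q ^ k <> 1) ->
  (1 - c) * (1 - c / (A * B)) * sum_n (gauss_term A B c q) n
  - (1 - c / A) * (1 - c / B) * sum_n (gauss_term A B (c * q) q) n
  = - (1 - c) * ((1 - q ^ S n) * gauss_term A B c q (S n)).
Proof.
  intros Hq HA HB Hc.
  assert (Hstep : forall k,
    (1 - c) * (1 - c / (A * B)) * gauss_term A B c q k
    - (1 - c / A) * (1 - c / B) * gauss_term A B (c * q) q k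
    = (1 - c) * ((1 - q ^ k) * gauss_term A B c q k)
      - (1 - c) * ((1 - q ^ S k) * gauss_term A B c q (S k))).
  { intro k.
    pose proof (one_minus_neq_0 _ (Hc k)) as H1.
    pose proof (gauss_term_S A B c q k Hq HA HB Hc) as HS.
    pose proof (gauss_term_shift A B c q k Hq HA HB Hc) as Hsh.
    change (q ^ S k) with (q * q ^ k).
    set (g := gauss_term A B c q k) in *.
    set (g1 := gauss_term A B c q (S k)) in *.
    set (g' := gauss_term A B (c * q) q k) in *.
    set (Q := q ^ k) in *.
    replace g' with ((1 - c) * Q * g / (1 - c * Q))
      by (rewrite <- Hsh; field; exact H1).
    replace ((1 - q * Q) * g1)
      with ((1 - A * Q) * (1 - B * Q) * (c / (A * B)) * g / (1 - c * Q))
      by (rewrite <- HS; field; exact H1).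
    field. now repeat split. }
  induction n as [|n IH].
  - rewrite !Csum_0, Hstep. simpl. ring.
  - rewrite !Csum_S. rewrite !Cmult_plus_distr_l.
    match goal with |- ?a + ?b - (?x + ?y) = _ =>
      replace (a + b - (x + y)) with ((a - x) + (b - y)) by ring end.
    rewrite IH, Hstep. ring.
Qed.

(** The constant does not depend on the shift [N], because
    [(c q^N; q)_n = (c;q)_(N+n) / (c;q)_N] and both factors on the right are
    bounded and bounded away from 0. *)
Lemma gauss_term_bound (A B c q : C) :
  (Cmod q < 1)%R -> A <> 0 -> B <> 0 -> (forall k, c * q ^ k <> 1) ->
  exists K, (0 <= K)%R /\ forall N n,
    (Cmod (gauss_term A B (c * q ^ N) q n)
     <= K * (Cmod q ^ N) ^ n * Cmod (c / (A * B)) ^ n)%R.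
Proof.
  intros Hq HA HB Hc.
  destruct (qpoch_bounded A q Hq) as [MA [HMA HA']].
  destruct (qpoch_bounded B q Hq) as [MB [HMB HB']].
  destruct (qpoch_bounded c q Hq) as [Mc [HMc Hc']].
  destruct (qpoch_bounded_below c q Hq Hc) as [mc [Hmc Hc'']].
  destruct (qpoch_bounded_below q q Hq (fun k => pow_q_neq_1 q k Hq))
    as [mq [Hmq Hq'']].
  exists (MA * MB * Mc / (mq * mc))%R. split.
  { apply Rlt_le, Rdiv_lt_0_compat; repeat apply Rmult_lt_0_compat; assumption. }
  intros N n. unfold gauss_term.
  pose proof (qpoch_neq_0 c q N Hc) as H1.
  pose proof (qpoch_neq_0 q q n (fun k => pow_q_neq_1 q k Hq)) as H2.
  pose proof (qpoch_neq_0 c q (N + n) Hc) as H3.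
  pose proof (qpoch_neq_0 (c * q ^ N) q n (shift_neq_1 c q N Hc)) as H4.
  replace (c * q ^ N / (A * B)) with (q ^ N * (c / (A * B))) by (field; now split).
  rewrite Cpow_mult_l.
  replace (qpoch A q n * qpoch B q n / (qpoch q q n * qpoch (c * q ^ N) q n))
    with (qpoch A q n * qpoch B q n * qpoch c q N / (qpoch q q n * qpoch c q (N + n)))
    by (rewrite qpoch_add; field; now repeat split).
  rewrite !Cmod_mult, !Cmod_pow, <- Rmult_assoc.
  apply Rmult_le_compat_r; [apply pow_le, Cmod_ge_0|].
  apply Rmult_le_compat_r; [apply pow_le, pow_le, Cmod_ge_0|].
  rewrite Cmod_div by now apply Cmult_neq_0. rewrite !Cmod_mult.
  assert (Hpos : forall z, (0 <= Cmod z)%R) by (intro; apply Cmod_ge_0).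
  apply Rmult_le_compat; [repeat apply Rmult_le_pos; apply Hpos| | |].
  - apply Rlt_le, Rinv_0_lt_compat, Rmult_lt_0_compat; now apply Cmod_gt_0.
  - apply Rmult_le_compat; [apply Rmult_le_pos; apply Hpos|apply Hpos| |apply Hc'].
    apply Rmult_le_compat; auto.
  - apply Rinv_le_contravar; [now apply Rmult_lt_0_compat|].
    apply Rmult_le_compat; auto with real; apply Rlt_le; assumption.
Qed.

Lemma gauss_sum_converges (A B c q : C) :
  (Cmod q < 1)%R -> A <> 0 -> B <> 0 -> (forall k, c * q ^ k <> 1) ->
  (Cmod (c / (A * B)) < 1)%R ->
  exists l, Clim (sum_n (gauss_term A B c q)) l.
Proof.
  intros Hq HA HB Hc HX.
  destruct (gauss_term_bound A B c q Hq HA HB Hc) as [K [HK Hb]].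
  apply (ex_series_le (V := C_CompleteNormedModule) (gauss_term A B c q))
    with (fun n => K * Cmod (c / (A * B)) ^ n)%R.
  - intro n. specialize (Hb 0%nat n). simpl in Hb.
    rewrite Cmult_1_r, pow1, Rmult_1_r in Hb. exact Hb.
  - apply (ex_series_scal (K := R_AbsRing) (V := R_NormedModule) K).
    apply ex_series_geom. rewrite Rabs_pos_eq by apply Cmod_ge_0. exact HX.
Qed.

Lemma gauss_term_Clim_0 (A B c q : C) :
  (Cmod q < 1)%R -> A <> 0 -> B <> 0 -> (forall k, c * q ^ k <> 1) ->
  (Cmod (c / (A * B)) < 1)%R -> Clim (gauss_term A B c q) 0.
Proof.
  intros Hq HA HB Hc HX.
  destruct (gauss_term_bound A B c q Hq HA HB Hc) as [K [HK Hb]].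
  apply Clim_0_le with (fun n => K * Cmod (c / (A * B)) ^ n)%R.
  - intro n. specialize (Hb 0%nat n). simpl in Hb.
    rewrite Cmult_1_r, pow1, Rmult_1_r in Hb. exact Hb.
  - apply is_lim_seq_scal_0, is_lim_seq_geom.
    rewrite Rabs_pos_eq by apply Cmod_ge_0. exact HX.
Qed.

Lemma shift_arg_lt (A B c q : C) (N : nat) :
  (Cmod q < 1)%R -> A <> 0 -> B <> 0 -> (Cmod (c / (A * B)) < 1)%R ->
  (Cmod (c * q ^ N / (A * B)) < 1)%R.
Proof.
  intros Hq HA HB HX.
  replace (c * q ^ N / (A * B)) with (c / (A * B) * q ^ N) by (field; now split).
  now apply Cmod_mult_pow_lt.
Qed.

Lemma gauss_contiguous (A B c q S0 S1 : C) :
  (Cmod q < 1)%R -> A <> 0 -> B <> 0 -> (forall k, c * q ^ k <> 1) ->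
  (Cmod (c / (A * B)) < 1)%R ->
  Clim (sum_n (gauss_term A B c q)) S0 ->
  Clim (sum_n (gauss_term A B (c * q) q)) S1 ->
  (1 - c) * (1 - c / (A * B)) * S0 = (1 - c / A) * (1 - c / B) * S1.
Proof.
  intros Hq HA HB Hc HX H0 H1.
  set (u := (1 - c) * (1 - c / (A * B))). set (v := (1 - c / A) * (1 - c / B)).
  assert (Hl : Clim (fun n => u * sum_n (gauss_term A B c q) n
                      - v * sum_n (gauss_term A B (c * q) q) n) (u * S0 - v * S1)).
  { apply Clim_minus; apply Clim_mult; trivial; apply Clim_const. }
  assert (Hr : Clim (fun n => u * sum_n (gauss_term A B c q) n
                      - v * sum_n (gauss_term A B (c * q) q) n) 0).
  { apply (Clim_ext
      (fun n => - (1 - c) * ((1 - q ^ S n) * gauss_term A B c q (S n)))).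
    { intro n. symmetry. now apply gauss_sum_contiguous. }
    replace (RtoC 0) with (- (1 - c) * ((1 - 0) * 0)) by ring.
    apply Clim_mult; [apply Clim_const|].
    apply (Clim_incr (fun n => (1 - q ^ n) * gauss_term A B c q n)).
    apply Clim_mult; [|now apply gauss_term_Clim_0].
    apply Clim_minus; [apply Clim_const | now apply Clim_pow]. }
  pose proof (Clim_unique _ _ _ Hl Hr) as E.
  replace (u * S0) with (u * S0 - v * S1 + v * S1) by ring. rewrite E. ring.
Qed.

Lemma gauss_iterate (A B c q S0 SN : C) (N : nat) :
  (Cmod q < 1)%R -> A <> 0 -> B <> 0 -> (forall k, c * q ^ k <> 1) ->
  (Cmod (c / (A * B)) < 1)%R ->
  Clim (sum_n (gauss_term A B c q)) S0 ->
  Clim (sum_n (gauss_term A B (c * q ^ N) q)) SN ->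
  qpoch c q N * qpoch (c / (A * B)) q N * S0
  = qpoch (c / A) q N * qpoch (c / B) q N * SN.
Proof.
  intros Hq HA HB Hc HX H0. revert SN. induction N as [|N IH]; intros SN HN.
  - simpl in HN. rewrite Cmult_1_r in HN.
    rewrite (Clim_unique _ _ _ H0 HN). reflexivity.
  - destruct (gauss_sum_converges A B (c * q ^ N) q Hq HA HB (shift_neq_1 c q N Hc)
      (shift_arg_lt A B c q N Hq HA HB HX)) as [T HT].
    replace (c * q ^ S N) with (c * q ^ N * q) in HN by (simpl; ring).
    pose proof (gauss_contiguous A B (c * q ^ N) q T SN Hq HA HB
      (shift_neq_1 c q N Hc) (shift_arg_lt A B c q N Hq HA HB HX) HT HN) as E.
    specialize (IH T HT). simpl.
    transitivity ((1 - c * q ^ N) * (1 - c / (A * B) * q ^ N)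
      * (qpoch c q N * qpoch (c / (A * B)) q N * S0)); [ring|].
    rewrite IH.
    transitivity (qpoch (c / A) q N * qpoch (c / B) q N
      * ((1 - c * q ^ N) * (1 - c * q ^ N / (A * B)) * T)); [field; now split|].
    rewrite E. field. now split.
Qed.

(** The term of index 0 is 1, and by [gauss_term_bound] each later term carries
    a factor [|q|^N] on top of a geometric majorant independent of [N]. *)
Lemma gauss_shifted_near_1 (A B c q : C) :
  (Cmod q < 1)%R -> A <> 0 -> B <> 0 -> (forall k, c * q ^ k <> 1) ->
  (Cmod (c / (A * B)) < 1)%R ->
  exists K, forall N l, Clim (sum_n (gauss_term A B (c * q ^ N) q)) l ->
    (Cmod (l - 1) <= K * Cmod q ^ N)%R.
Proof.
  intros Hq HA HB Hc HX.
  destruct (gauss_term_bound A B c q Hq HA HB Hc) as [K [HK Hb]].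
  set (X := Cmod (c / (A * B))) in *.
  assert (HX0 : (0 <= X)%R) by apply Cmod_ge_0.
  exists (K * (1 / (1 - X)))%R. intros N l HS.
  set (g := gauss_term A B (c * q ^ N) q) in *.
  set (r := (Cmod q ^ N)%R) in *.
  assert (Hr : (0 <= r <= 1)%R).
  { pose proof (Cmod_ge_0 q). apply pow_unit_interval. lra. }
  assert (Hp : forall n, (Cmod (sum_n g n - 1) <= K * r * ((1 - X ^ n) / (1 - X)))%R).
  { induction n as [|n IH].
    - rewrite Csum_0. unfold g, gauss_term. simpl.
      match goal with |- (Cmod ?z <= _)%R => replace z with (RtoC 0)
        by field end.
      rewrite Cmod_0. apply Req_le. field. lra.
    - rewrite Csum_S.
      replace (sum_n g n + g (S n) - 1) with ((sum_n g n - 1) + g (S n)) by ring.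
      replace (K * r * ((1 - X ^ S n) / (1 - X)))%R
        with (K * r * ((1 - X ^ n) / (1 - X)) + K * r * X ^ n)%R
        by (simpl; field; lra).
      eapply Rle_trans; [apply Cmod_triangle|]. apply Rplus_le_compat; [exact IH|].
      eapply Rle_trans; [apply Hb|]. fold r. simpl.
      assert (0 <= r ^ n <= 1)%R by now apply pow_unit_interval.
      assert (0 <= X ^ n)%R by now apply pow_le.
      apply Rmult_le_compat; [|nra| |nra].
      + apply Rmult_le_pos; [exact HK|nra].
      + apply Rmult_le_compat_l; [exact HK|nra]. }
  apply Clim_Cmod_le with (fun n => sum_n g n - 1).
  - intro n. eapply Rle_trans; [apply Hp|].
    destruct (geom_nonneg X n (conj HX0 HX)) as [_ Hg].
    rewrite Rmult_assoc, (Rmult_comm r), <- Rmult_assoc.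
    apply Rmult_le_compat_r; [lra|]. now apply Rmult_le_compat_l.
  - apply Clim_minus; [exact HS | apply Clim_const].
Qed.

(** The q-Gauss sum, obtained by letting the number of contiguous steps in
    [gauss_iterate] tend to infinity. *)
Theorem q_gauss_sum (A B c q : C) :
  (Cmod q < 1)%R -> A <> 0 -> B <> 0 -> (forall k, c * q ^ k <> 1) ->
  (Cmod (c / (A * B)) < 1)%R ->
  Clim (sum_n (gauss_term A B c q))
    (qpoch_inf (c / A) q * qpoch_inf (c / B) q
     / (qpoch_inf c q * qpoch_inf (c / (A * B)) q)).
Proof.
  intros Hq HA HB Hc HX.
  destruct (gauss_sum_converges A B c q Hq HA HB Hc HX) as [S0 HS0].
  destruct (gauss_shifted_near_1 A B c q Hq HA HB Hc HX) as [K HK].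
  set (Sh := fun N => iota (fun l : C_CompleteNormedModule =>
    Clim (sum_n (gauss_term A B (c * q ^ N) q)) l)).
  assert (HSh : forall N, Clim (sum_n (gauss_term A B (c * q ^ N) q)) (Sh N)).
  { intro N. destruct (gauss_sum_converges A B (c * q ^ N) q Hq HA HB
      (shift_neq_1 c q N Hc) (shift_arg_lt A B c q N Hq HA HB HX)) as [T HT].
    assert (E : Sh N = T) by exact (iota_filterlim_locally
      (sum_n (gauss_term A B (c * q ^ N) q)) T HT).
    rewrite E. exact HT. }
  assert (HSh1 : Clim Sh 1).
  { apply (Clim_ext (fun N => (Sh N - 1) + 1)); [intro; ring|].
    enough (H : Clim (fun N => Sh N - 1 + 1) (0 + 1))
      by now rewrite Cplus_0_l in H.
    apply Clim_plus; [|apply Clim_const].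
    apply Clim_0_le with (fun N => K * Cmod q ^ N)%R; [intro N; now apply HK|].
    apply is_lim_seq_scal_0, is_lim_seq_geom.
    rewrite Rabs_pos_eq by apply Cmod_ge_0. exact Hq. }
  assert (E : qpoch_inf c q * qpoch_inf (c / (A * B)) q * S0
              = qpoch_inf (c / A) q * qpoch_inf (c / B) q * 1).
  { apply (Clim_unique (fun N => qpoch c q N * qpoch (c / (A * B)) q N * S0)).
    - apply Clim_mult; [|apply Clim_const].
      apply Clim_mult; apply qpoch_Clim; exact Hq.
    - apply (Clim_ext (fun N => qpoch (c / A) q N * qpoch (c / B) q N * Sh N)).
      + intro N. symmetry. now apply gauss_iterate.
      + apply Clim_mult; [|exact HSh1].
        apply Clim_mult; apply qpoch_Clim; exact Hq. }
  rewrite Cmult_1_r in E. rewrite <- E.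
  assert (H1 : qpoch_inf c q <> 0) by now apply qpoch_inf_neq_0.
  assert (H2 : qpoch_inf (c / (A * B)) q <> 0).
  { apply qpoch_inf_neq_0; [exact Hq|]. intro k.
    now apply neq_1_of_Cmod_lt, Cmod_mult_pow_lt. }
  replace (qpoch_inf c q * qpoch_inf (c / (A * B)) q * S0
    / (qpoch_inf c q * qpoch_inf (c / (A * B)) q)) with S0
    by (field; now split).
  exact HS0.
Qed.

(** * The reduction to the q-Gauss sum *)

(** This is [(1-dq) / (1-dq^(n+1))] as long as [dq] is not 1.  The products are
    kept so that the case [dq = 1], where the closed form is 0/0 at [n = 0],
    needs no separate treatment. *)
Definition weight (d q : C) (n : nat) : C := qpoch (d * q) q n / qpoch (d * q ^ 2) q n.

Lemma dq2_neq_1 (d q : C) :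
  (forall k : nat, d * q ^ (k + 2) <> 1) -> forall k, d * q ^ 2 * q ^ k <> 1.
Proof.
  intros H k. rewrite <- Cmult_assoc, <- Cpow_add_r, Nat.add_comm. apply H.
Qed.

Lemma weight_S (d q : C) (n : nat) :
  (forall k, d * q ^ 2 * q ^ k <> 1) ->
  (1 - d * q ^ 2 * q ^ n) * weight d q (S n) = (1 - d * q * q ^ n) * weight d q n.
Proof.
  intro H. unfold weight.
  change (qpoch (d * q) q (S n)) with (qpoch (d * q) q n * (1 - d * q * q ^ n)).
  change (qpoch (d * q ^ 2) q (S n))
    with (qpoch (d * q ^ 2) q n * (1 - d * q ^ 2 * q ^ n)).
  pose proof (qpoch_neq_0 _ _ n H). pose proof (one_minus_neq_0 _ (H n)).
  field_simplify_eq; [ring|now split].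
Qed.

Lemma weight_closed (d q : C) (n : nat) :
  (forall k, d * q ^ 2 * q ^ k <> 1) ->
  (1 - d * q * q ^ n) * weight d q n = 1 - d * q.
Proof.
  intro H. induction n as [|n IH].
  - unfold weight. simpl. field.
  - rewrite <- IH, <- (weight_S d q n H). simpl. ring.
Qed.

(** Compares the two series through [(1 - A) (Aq;q)_n = (A;q)_n (1 - A q^n)]. *)
Lemma phi32_term_gauss (A B c d q : C) (n : nat) :
  (Cmod q < 1)%R -> (forall k, c * q ^ k <> 1) -> (forall k, d * q ^ 2 * q ^ k <> 1) ->
  (1 - A) * (1 - B) * phi32_term (A * q) (B * q) d c (d * q ^ 2) q (c / (A * B)) n
  = (1 - A * q ^ n) * (1 - B * q ^ n) * gauss_term A B c q n
    * (qpoch d q n / qpoch (d * q ^ 2) q n).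
Proof.
  intros Hq Hc Hd. unfold phi32_term, gauss_term.
  pose proof (qpoch_head A q n) as HA. simpl in HA.
  pose proof (qpoch_head B q n) as HB. simpl in HB.
  pose proof (qpoch_neq_0 c q n Hc).
  pose proof (qpoch_neq_0 q q n (fun k => pow_q_neq_1 q k Hq)).
  pose proof (qpoch_neq_0 _ q n Hd).
  transitivity (((1 - A) * qpoch (A * q) q n) * ((1 - B) * qpoch (B * q) q n)
    * qpoch d q n / (qpoch q q n * qpoch c q n * qpoch (d * q ^ 2) q n)
    * (c / (A * B)) ^ n).
  - set (Y := (c / (A * B)) ^ n). field. now repeat split.
  - rewrite <- HA, <- HB. set (Y := (c / (A * B)) ^ n). field. now repeat split.
Qed.

(** The last hypothesis is the definition of [d] cleared of denominators.  Under
    it the difference of the two summands is an exact difference of the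
    boundary terms displayed on the right; at index 0 this amounts to
    [(X - q) (1 - d) = X (1 - A) (1 - B)]. *)
Lemma phi32_partial_sum (A B c d q X : C) (n : nat) :
  (Cmod q < 1)%R -> A <> 0 -> B <> 0 -> A <> 1 -> B <> 1 ->
  (forall k, c * q ^ k <> 1) -> (forall k, d * q ^ 2 * q ^ k <> 1) ->
  X = c / (A * B) -> X <> q ->
  d * (X - q) = X * A + X * B - q - X * A * B ->
  sum_n (phi32_term (A * q) (B * q) d c (d * q ^ 2) q X) n
  = (1 - d * q) / (1 - q) * sum_n (gauss_term A B c q) n
    - q / ((X - q) * (1 - q)) * (X * (1 - A * q ^ n) * (1 - B * q ^ n))
      * (weight d q n * gauss_term A B c q n).
Proof.
  intros Hq HA HB HA1 HB1 Hc Hd HX HXq Hrel.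
  pose proof (Cminus_neq_0 _ _ HXq) as HXq'.
  pose proof (one_minus_neq_0 _ HA1) as HA1'.
  pose proof (one_minus_neq_0 _ HB1) as HB1'.
  pose proof (one_minus_neq_0 _ (neq_1_of_Cmod_lt q Hq)) as Hq1.
  assert (Hd1 : (X - q) * (1 - d) = X * (1 - A) * (1 - B)).
  { transitivity (X - q - d * (X - q)); [ring|]. rewrite Hrel. ring. }
  induction n as [|n IH].
  - rewrite !Csum_0. unfold phi32_term, gauss_term, weight. simpl.
    transitivity ((1 - d * q) / (1 - q) - q / ((X - q) * (1 - q)) * ((X - q) * (1 - d))).
    + field. now repeat split.
    + rewrite Hd1. field. now repeat split.
  - rewrite !Csum_S, IH.
    pose proof (phi32_term_gauss A B c d q (S n) Hq Hc Hd) as Ht.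
    pose proof (gauss_term_S A B c q n Hq HA HB Hc) as Hg.
    pose proof (weight_S d q n Hd) as Hw.
    pose proof (weight_closed d q n Hd) as HL.
    pose proof (qpoch_neq_0 _ q n Hd) as Hn.
    pose proof (one_minus_neq_0 _ (Hd n)) as HD.
    assert (Hdn : qpoch d q (S n) / qpoch (d * q ^ 2) q (S n)
                  = (1 - d) * weight d q n / (1 - d * q ^ 2 * q ^ n)).
    { rewrite qpoch_head. unfold weight.
      change (qpoch (d * q ^ 2) q (S n))
        with (qpoch (d * q ^ 2) q n * (1 - d * q ^ 2 * q ^ n)).
      field. now split. }
    rewrite Hdn in Ht. rewrite <- HX in Ht, Hg.
    assert (Hcx : c = X * A * B) by (rewrite HX; field; now split).
    change (q ^ S n) with (q * q ^ n) in *.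
    set (t := phi32_term _ _ _ _ _ _ _ (S n)) in *.
    set (g1 := gauss_term A B c q (S n)) in *.
    set (g := gauss_term A B c q n) in *.
    set (w1 := weight d q (S n)) in *. set (w := weight d q n) in *.
    set (Q := q ^ n) in *. set (D := 1 - d * q ^ 2 * Q) in *.
    assert (Et : t = X * (1 - A * (q * Q)) * (1 - B * (q * Q)) * g1 * w
                     / ((X - q) * D)).
    { transitivity ((1 - A) * (1 - B) * t / ((1 - A) * (1 - B)));
        [field; now split|].
      rewrite Ht.
      transitivity ((1 - A * (q * Q)) * (1 - B * (q * Q)) * g1 * w
        * ((X - q) * (1 - d)) / ((X - q) * D * (1 - A) * (1 - B)));
        [field; now repeat split|].
      rewrite Hd1. field. now repeat split. }
    assert (Ew : w1 = (1 - d * q * Q) * w / D) by (rewrite <- Hw; field; exact HD).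
    assert (Eg : X * (1 - A * Q) * (1 - B * Q) * g
                 = (1 - q * Q) * (1 - c * Q) * g1) by (rewrite Hg; ring).
    rewrite Et, Ew, <- HL.
    set (G := sum_n (gauss_term A B c q) n).
    match goal with |- @eq _ ?l ?r => change (@eq C l r) end.
    transitivity ((1 - d * q * Q) * w / (1 - q) * G
      - q / ((X - q) * (1 - q)) * w * (X * (1 - A * Q) * (1 - B * Q) * g)
      + X * (1 - A * (q * Q)) * (1 - B * (q * Q)) * g1 * w / ((X - q) * D));
      [ring|].
    rewrite Eg, Hcx.
    (* The two sides differ by a multiple of the relation defining [d]: up to
       the common factor [w * g1] and the denominators, the cofactor is
       [q^(n+1) (1 - d q^(n+2))]. *)
    match goal with |- ?l = ?r =>
      replace l with (r + (d * (X - q) - (X * A + X * B - q - X * A * B))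
        * (q * Q - d * q * (q * Q) ^ 2) * w * g1 / ((X - q) * (1 - q) * D)) end.
    + rewrite Hrel. field. now repeat split.
    + unfold D. field. now repeat split.
Qed.

Lemma weight_bounded (d q : C) :
  (Cmod q < 1)%R -> (forall k, d * q ^ 2 * q ^ k <> 1) ->
  exists M, forall n, (Cmod (weight d q n) <= M)%R.
Proof.
  intros Hq Hd.
  destruct (qpoch_bounded (d * q) q Hq) as [M [HM HM']].
  destruct (qpoch_bounded_below (d * q ^ 2) q Hq Hd) as [m [Hm Hm']].
  exists (M / m)%R. intro n. unfold weight.
  rewrite Cmod_div by now apply qpoch_neq_0.
  apply Rmult_le_compat; [apply Cmod_ge_0| |apply HM'|].
  - apply Rlt_le, Rinv_0_lt_compat, Cmod_gt_0. now apply qpoch_neq_0.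
  - now apply Rinv_le_contravar.
Qed.

(** The boundary term in [phi32_partial_sum] tends to 0, since [g_n] does and
    its coefficients are bounded; what remains is a multiple of the q-Gauss
    sum. *)
Lemma phi32_sum_limit (A B c d q X : C) :
  (Cmod q < 1)%R -> A <> 0 -> B <> 0 -> A <> 1 -> B <> 1 ->
  (forall k, c * q ^ k <> 1) -> (forall k, d * q ^ 2 * q ^ k <> 1) ->
  X = c / (A * B) -> (Cmod X < 1)%R -> X <> q ->
  d * (X - q) = X * A + X * B - q - X * A * B ->
  Clim (sum_n (phi32_term (A * q) (B * q) d c (d * q ^ 2) q X))
    ((1 - d * q) / (1 - q)
     * (qpoch_inf (c / A) q * qpoch_inf (c / B) q
        / (qpoch_inf c q * qpoch_inf X q))).
Proof.
  intros Hq HA HB HA1 HB1 Hc Hd HX HX1 HXq Hrel.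
  set (L := (1 - d * q) / (1 - q)). set (k := q / ((X - q) * (1 - q))).
  apply (Clim_ext (fun n => L * sum_n (gauss_term A B c q) n
    - k * (weight d q n
      * (X * (1 - A * q ^ n) * (1 - B * q ^ n) * gauss_term A B c q n)))).
  { intro n. rewrite (phi32_partial_sum A B c d q X n) by assumption.
    fold L k. match goal with |- @eq _ ?l ?r => change (@eq C l r) end. ring. }
  match goal with |- Clim _ ?l => replace l with (l - k * 0) by ring end.
  rewrite HX in HX1.
  apply Clim_minus; (apply Clim_mult; [apply Clim_const|]).
  - rewrite HX. now apply q_gauss_sum.
  - destruct (weight_bounded d q Hq Hd) as [M HM].
    apply Clim_0_bounded_mult with M; [exact HM|].
    replace (RtoC 0) with (X * (1 - A * 0) * (1 - B * 0) * 0) by ring.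
    apply Clim_mult; [|now apply gauss_term_Clim_0].
    assert (Hf : forall z, Clim (fun n => 1 - z * q ^ n) (1 - z * 0)).
    { intro z. apply Clim_minus; [apply Clim_const|].
      apply Clim_mult; [apply Clim_const | now apply Clim_pow]. }
    apply Clim_mult; [|apply Hf]. apply Clim_mult; [apply Clim_const | apply Hf].
Qed.

Theorem theorem3 (q a b c d : C)
  (hq0 : q <> 0) (hq1 : (Cmod q < 1)%R)
  (ha0 : a <> 0) (hb0 : b <> 0) (hc0 : c <> 0)
  (hx : (Cmod (c * q ^ 2 / (a * b)) < 1)%R)
  (hab : a * b <> c * q)
  (hd : d = (a * b * q + a * b * c - a * c * q - b * c * q)
            / ((a * b - c * q) * q))
  (haq : a <> q) (hbq : b <> q)
  (hc : forall k : nat, c * q ^ k <> 1)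
  (hdq : forall k : nat, d * q ^ (k + 2) <> 1) :
  phi32_converges a b d c (d * q ^ 2) q (c * q ^ 2 / (a * b)) /\
  phi32 a b d c (d * q ^ 2) q (c * q ^ 2 / (a * b)) =
    - ((a * b - c * q) * (1 - d) * (1 - d * q) * q
       / ((1 - q) * (q - a) * (q - b) * c))
    * (qpoch_inf (c * q / a) q * qpoch_inf (c * q / b) q
       / (qpoch_inf c q * qpoch_inf (c * q ^ 2 / (a * b)) q)).
Proof.
  pose proof (Cminus_neq_0 _ _ hab) as hab'.
  pose proof (Cminus_neq_0 _ _ (not_eq_sym haq)) as haq'.
  pose proof (Cminus_neq_0 _ _ (not_eq_sym hbq)) as hbq'.
  pose proof (one_minus_neq_0 _ (neq_1_of_Cmod_lt q hq1)) as hq1'.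
  assert (Hlim : Clim (sum_n (phi32_term a b d c (d * q ^ 2) q (c * q ^ 2 / (a * b))))
    ((1 - d * q) / (1 - q)
     * (qpoch_inf (c * q / a) q * qpoch_inf (c * q / b) q
        / (qpoch_inf c q * qpoch_inf (c * q ^ 2 / (a * b)) q)))).
  { assert (Hquot : forall z : C, z <> q -> z / q <> 1).
    { intros z Hz E. apply Hz. replace z with (z / q * q) by (field; exact hq0).
      rewrite E. ring. }
    assert (Hquot0 : forall z : C, z <> 0 -> z / q <> 0).
    { intros z Hz E. apply Hz. replace z with (z / q * q) by (field; exact hq0).
      rewrite E. ring. }
    pose proof (phi32_sum_limit (a / q) (b / q) c d q (c * q ^ 2 / (a * b))) as H.
    replace (a / q * q) with a in H by (field; exact hq0).
    replace (b / q * q) with b in H by (field; exact hq0).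
    replace (c / (a / q)) with (c * q / a) in H by (field; now split).
    replace (c / (b / q)) with (c * q / b) in H by (field; now split).
    apply H; auto; clear H.
    - now apply dq2_neq_1.
    - field. now repeat split.
    - intro E. apply hab.
      transitivity (a * b * (c * q ^ 2 / (a * b)) / q); [rewrite E|]; field;
        now repeat split.
    - rewrite hd. field. now repeat split. }
  assert (Hpre : - ((a * b - c * q) * (1 - d) * (1 - d * q) * q
       / ((1 - q) * (q - a) * (q - b) * c)) = (1 - d * q) / (1 - q)).
  { replace (1 - d) with (- (c * (q - a) * (q - b) / ((a * b - c * q) * q)))
      by (rewrite hd; field; now split).
    field. now repeat split. }
  rewrite Hpre. split; [eexists; exact Hlim|].
  exact (iota_filterlim_locally _ _ Hlim).
Qed.
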